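(* Let $1<\beta\le2$. There is a set $\mathcal F\subset[0,1]$ of full Lebesgue measure such that for every $x\in\mathcal F$ and every $\alpha\in(0,1)$, the function $G_\beta$ is pointwise $\alpha$-Hölder continuous at $x$; that is, there exists a constant $C=C(x,\alpha)>0$ with $|G_\beta(y)-G_\beta(x)|\le C|y-x|^\alpha$ for all $y\in(0,1)$.
   Context: Fix $1<\beta\le 2$. The beta-map is $\tau_\beta:[0,1]\to[0,1]$, $\tau_\beta(x)=\beta x-[\beta x]$, where $[y]$ is the integer part of $y$. Let $m_\beta$ be the unique $\tau_\beta$-invariant Borel probability measure absolutely continuous with respect to Lebesgue measure. For $x\in[0,1]$ and $n\ge1$ the digits are $g_n(x)=[\beta\,\tau_\beta^{n-1}(x)]$, so that $x=\sum_{n\ge1}g_n(x)\beta^{-n}$ (greedy $\beta$-expansion). Put $M_\beta=m_\beta([1/\beta,1])=\int_0^1 g_1\,dm_\beta$. The generalized Takagi function is \[ G_\beta(x)=\frac{g_1(x)}{\beta}+\sum_{n=2}^\infty\frac{g_n(x)}{\beta^n}\Bigl(n-\frac{1}{M_\beta}\sum_{i=1}^{n-1}g_i(x)\Bigr),\qquad x\in[0,1]. \] *)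

(* Defs.v *)
From HB Require Import structures.
From mathcomp Require Import all_boot all_order all_algebra.
From mathcomp Require Import all_classical all_reals all_analysis.
Set Implicit Arguments. Unset Strict Implicit. Unset Printing Implicit Defensive.
Import Order.TTheory GRing.Theory Num.Theory.
Local Open Scope classical_set_scope.
Local Open Scope ring_scope.

Definition beta_map (R : realType) (beta : R) (x : R) : R :=
  beta * x - (Num.floor (beta * x))%:~R.

(* Digits: g_n(x) = [beta * tau^(n-1)(x)], meaningful for n >= 1. *)
Definition digit (R : realType) (beta : R) (n : nat) (x : R) : R :=
  (Num.floor (beta * iter n.-1 (beta_map beta) x))%:~R.

Definition Mbeta (R : realType) (beta : R) (m : set R -> \bar R) : R :=
  fine (m [set` `[beta^-1, 1]]).

(* n-th term (n = k+1) of the series defining G_beta: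
   g_n(x)/beta^n * (n - (1/M) * sum_{i=1}^{n-1} g_i(x)).
   For n = 1 this equals g_1(x)/beta, as in the definition. *)
Definition takagi_term (R : realType) (beta M : R) (x : R) (k : nat) : R :=
  digit beta k.+1 x / beta ^+ k.+1 *
  (k.+1%:R - M^-1 * \sum_(i < k) digit beta i.+1 x).

Definition takagi (R : realType) (beta : R) (m : set R -> \bar R) (x : R) : R :=
  limn (fun n => \sum_(k < n) takagi_term beta (Mbeta beta m) x k).

Definition beta_invariant (R : realType) (beta : R) (m : set R -> \bar R) :=
  forall A : set R, measurable A -> A `<=` [set` `[0, 1]] ->
    m ([set x | x \in `[0, 1] /\ beta_map beta x \in A]) = m A.

(* Main.v *)
(* Since |g_n| <= 1, the n-th term of the series is O(n beta^-n), so if x and y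
   first differ at digit k+1 then |G y - G x| = O(k beta^-k). At that digit the
   k-th iterates of x and y lie on both sides of 1/beta, hence
   beta^k |y - x| >= |tau^k x - 1/beta|. The tau^k-preimage of an interval of
   length l has Lebesgue measure at most (k+1) l, so a Borel-Cantelli argument
   shows that for almost every x the right-hand side is at least e (k+2)^-3 for
   some e > 0 and all k; these polynomial losses are absorbed by the gap between
   alpha and 1. *)
Require Import Defs.
From HB Require Import structures.
From mathcomp Require Import all_boot all_order all_algebra.
From mathcomp Require Import all_classical all_reals all_analysis.
From mathcomp Require Import ring lra.
Import Order.TTheory GRing.Theory Num.Theory.
Import numFieldNormedType.Exports.
Local Open Scope classical_set_scope.
Local Open Scope ring_scope.

(** * Geometric bounds for series with a common prefix *)

Section Series.
Context {R : realType}.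
Implicit Types (u v : nat -> R) (A r q : R).

(** The factor times [q - 1] is at least 1, so each step raises the right-hand side by at least 1.
    This trades the polynomial factors for an arbitrarily small exponential rate. *)
Lemma natr_le_exp q n : 1 < q -> n.+2%:R <= (2 + (q - 1)^-1) * q ^+ n.
Proof.
move=> q1; have q10 : 0 < q - 1 by rewrite subr_gt0.
have D0 : 0 < 2 + (q - 1)^-1 by rewrite addr_gt0// invr_gt0.
elim: n => [|n IH]; first by rewrite expr0 mulr1 lerDl invr_ge0 ltW.
have qn1 : 1 <= q ^+ n by rewrite exprn_ege1// ltW.
have : 1 <= (2 + (q - 1)^-1) * (q - 1) * q ^+ n.
  rewrite -[leLHS]mulr1 ler_pM// mulrDl mulVf ?gt_eqF// lerDr.
  by rewrite mulr_ge0// ltW.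
by rewrite exprS -natr1; lra.
Qed.

Lemma cvg_series_geometric_bound u A r : 0 <= A -> 0 <= r < 1 ->
  (forall k, `|u k| <= A * r ^+ k) -> cvgn (series u).
Proof.
move=> A0 /andP[r0 r1] uA; apply: normed_cvg.
apply: (@series_le_cvg _ _ (geometric A r)) => [k|k|k|].
- exact: normr_ge0.
- by rewrite /geometric/= mulr_ge0 ?exprn_ge0.
- exact: uA.
- by apply: is_cvg_geometric_series; rewrite ger0_norm.
Qed.

(** The common terms cancel, and what remains is at most twice the geometric tail from index [n]
    on. *)
Lemma lim_series_eq_prefix u v A r n : 0 <= A -> 0 <= r < 1 ->
  (forall k, `|u k| <= A * r ^+ k) -> (forall k, `|v k| <= A * r ^+ k) ->
  (forall k, (k < n)%N -> u k = v k) ->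
  `|limn (series u) - limn (series v)| <= A *+ 2 / (1 - r) * r ^+ n.
Proof.
move=> A0 /[dup] rP /andP[r0 r1] uA vA uv.
have cu := cvg_series_geometric_bound _ _ _ A0 rP uA.
have cv := cvg_series_geometric_bound _ _ _ A0 rP vA.
have r10 : 1 - r != 0 by rewrite subr_eq0 gt_eqF.
(* The right-hand side is the closed form of the geometric sum from [n] to [N]; [maxn] makes it
   vanish as long as [N <= n]. *)
have bound N : `|series u N - series v N| <=
    A *+ 2 / (1 - r) * (r ^+ n - r ^+ maxn N n).
  elim: N => [|N IH].
    by rewrite /series/= !big_geq// subrr normr0 max0n subrr mulr0.
  rewrite !seriesSr.
  have -> : series u N + u N - (series v N + v N) =
      (series u N - series v N) + (u N - v N) by ring.
  have [Nn|nN] := ltnP N n.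
    by rewrite (uv _ Nn) subrr addr0 (maxn_idPr Nn) -{2}(maxn_idPr (ltnW Nn)).
  rewrite (maxn_idPl (leqW nN)); rewrite (maxn_idPl nN) in IH.
  apply: le_trans (ler_normD _ _) _.
  have d : `|u N - v N| <= A *+ 2 * r ^+ N.
    apply: le_trans (ler_normB _ _) _.
    by have := uA N; have := vA N; lra.
  apply: le_trans (lerD IH d) _; rewrite le_eqVlt; apply/orP; left; apply/eqP.
  by rewrite exprS; field.
rewrite -limB// -lim_norm; last exact: is_cvgB.
apply: limr_le; first by apply: is_cvg_norm; exact: is_cvgB.
apply: nearW => N; apply: le_trans (bound N) _.
rewrite ler_wpM2l ?divr_ge0 ?mulrn_wge0 ?subr_ge0 ?(ltW r1)//.
by rewrite gerBl exprn_ge0.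
Qed.

End Series.

(** * Digits, orbits and inverse branches of the beta-map *)

Section BetaMap.
Context {R : realType}.
Implicit Types (b c t x y z M : R) (k n : nat).

Lemma beta_map_itv b x : 0 <= beta_map b x < 1.
Proof.
have /andP[] := floor_itv (b * x); rewrite intrD /beta_map => h1 h2.
by apply/andP; split; lra.
Qed.

Lemma iter_beta_map_itv b n x : 0 <= x < 1 -> 0 <= iter n (beta_map b) x < 1.
Proof. by case: n => [//|n] _; rewrite iterS beta_map_itv. Qed.

(** Here [0 <= b * z < 2], so the integer part is 0 or 1. At [z = 1] with [b = 2] it would be 2,
    whence the half-open interval. *)
Lemma floor_beta b z : 1 < b <= 2 -> 0 <= z < 1 ->
  (Num.floor (b * z))%:~R = (b^-1 <= z)%R%:R :> R.
Proof.
move=> /andP[b1 b2] /andP[z0 z1]; have b0 : 0 < b by lra.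
have -> : (b^-1 <= z) = (1 <= b * z) by rewrite -[b^-1]mulr1 ler_pdivrMl.
have bz2 : b * z < 2.
  by apply: lt_le_trans b2; rewrite -[ltRHS]mulr1 ltr_pM2l.
have bz0 : 0 <= b * z by rewrite mulr_ge0 ?(ltW b0).
case: (leP 1 (b * z)) => h.
  by rewrite (@floor_def _ _ 1)// h.
by rewrite (@floor_def _ _ 0)// bz0.
Qed.

Lemma digitE b k x : 1 < b <= 2 -> 0 <= x < 1 ->
  digit b k.+1 x = (b^-1 <= iter k (beta_map b) x)%R%:R.
Proof. by move=> hb hx; rewrite /digit/= floor_beta// iter_beta_map_itv. Qed.

Lemma beta_map_digit b k x :
  iter k.+1 (beta_map b) x = b * iter k (beta_map b) x - digit b k.+1 x.
Proof. by []. Qed.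

Lemma takagi_term_le b M k x : 1 < b <= 2 -> 0 <= x < 1 ->
  `|takagi_term b M x k| <= (1 + `|M^-1|) * k.+1%:R / b ^+ k.
Proof.
move=> hb hx; have /andP[b1 b2] := hb; have b0 : 0 < b by lra.
have d01 i : 0 <= digit b i.+1 x <= 1.
  by rewrite digitE// ler0n lern1 leq_b1.
rewrite /takagi_term mulrC normrM ler_pM//.
  apply: le_trans (ler_normB _ _) _.
  rewrite mulrDl mul1r ger0_norm// lerD2l normrM ler_wpM2l//.
  rewrite ger0_norm ?sumr_ge0// => [|i _]; last by have /andP[] := d01 i.
  apply: (@le_trans _ _ (\sum_(i < k) 1)).
    by apply: ler_sum => i _; have /andP[] := d01 i.
  by rewrite sumr_const card_ord ler_nat.
have /andP[d0 d1] := d01 k.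
rewrite normrM (ger0_norm d0) ger0_norm ?invr_ge0 ?exprn_ge0 ?(ltW b0)//.
rewrite -[leRHS]mul1r ler_pM ?invr_ge0 ?exprn_ge0 ?(ltW b0)//.
rewrite lef_pV2 ?posrE ?exprn_gt0// exprS ler_peMl ?exprn_ge0 ?(ltW b0)//.
exact: ltW.
Qed.

(** While the digits agree, both orbits follow the same affine branch of slope [b], so the
    subtracted digits cancel. *)
Lemma iter_beta_map_sub b k x y :
  (forall i, (i < k)%N -> digit b i.+1 x = digit b i.+1 y) ->
  iter k (beta_map b) y - iter k (beta_map b) x = b ^+ k * (y - x).
Proof.
elim: k => [|k IH] e; first by rewrite expr0 mul1r.
rewrite !beta_map_digit e// exprS -mulrA -IH; first by ring.
by move=> i ik; apply: e; exact: leqW.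
Qed.

(* At the first differing digit, [b^-1] separates the two orbit points. *)
Lemma first_digit_dist b k x y : 1 < b <= 2 -> 0 <= x < 1 -> 0 <= y < 1 ->
  (forall i, (i < k)%N -> digit b i.+1 x = digit b i.+1 y) ->
  digit b k.+1 x != digit b k.+1 y ->
  `|iter k (beta_map b) x - b^-1| <= b ^+ k * `|y - x|.
Proof.
move=> hb hx hy e; have b0 : 0 < b by lra.
rewrite -[b ^+ k]ger0_norm ?exprn_ge0 ?(ltW b0)// -normrM -iter_beta_map_sub//.
rewrite !digitE//.
set u := iter k _ x; set v := iter k _ y.
by case: (leP b^-1 u) => hu; case: (leP b^-1 v) => hv; rewrite ?eqxx// => _;
  rewrite ler_norml; apply/andP; split; case: ler0P; lra.
Qed.

(* Every inverse branch of the [n]-th iterate is affine of slope [b ^- n], and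
   the points [p] enumerate their (extrapolated) values at [c]. The bound is
   linear in [t] so that it survives the induction: [0, t) splits into the
   branch over [0, b t) or the branches over [0, 1) and [0, b t - 1). *)
Lemma preimage_centers b c n t : 1 < b <= 2 -> 0 <= t <= 1 ->
  exists2 P : seq R, (size P)%:R <= n%:R * b ^+ n * t + 1 &
    forall x, 0 <= x < t ->
      exists2 p, p \in P & `|iter n (beta_map b) x - c| = b ^+ n * `|x - p|.
Proof.
move=> hb; have b0 : 0 < b by lra.
have bn0 : b != 0 by rewrite gt_eqF.
elim: n t => [|n IH] t ht.
  exists [:: c]; first by rewrite !mul0r add0r.
  by move=> x hx; exists c; rewrite ?inE// mul1r.
have bn1 : 1 <= b ^+ n by rewrite exprn_ege1//; lra.
have nbt s : 0 <= s -> 0 <= n%:R * b ^+ n * s.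
  by move=> s0; rewrite !mulr_ge0 ?exprn_ge0 ?(ltW b0).
(* A center [p] for the point [b * x - e] pulls back along the branch with digit [e] to
   [(p + e) / b]. *)
have branch (e x p : R) : `|iter n (beta_map b) (b * x - e) - c| =
    b ^+ n * `|b * x - e - p| ->
    `|iter n (beta_map b) (b * x - e) - c| = b ^+ n.+1 * `|x - (p + e) / b|.
  move=> ->; have -> : b * x - e - p = b * (x - (p + e) / b) by field.
  by rewrite normrM (gtr0_norm b0) exprSr mulrA.
have step x : 0 <= x < 1 -> iter n.+1 (beta_map b) x =
    iter n (beta_map b) (b * x - (b^-1 <= x)%R%:R).
  by move=> hx; rewrite iterSr /beta_map floor_beta.
have [tb|tb] := leP t b^-1.
  have hbt : 0 <= b * t <= 1.
    have : b * t <= 1 by rewrite -ler_pdivlMl// mulr1.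
    by rewrite mulr_ge0 ?(ltW b0)//; lra.
  have [P sP hP] := IH (b * t) hbt.
  exists [seq (p + 0) / b | p <- P].
    rewrite size_map (le_trans sP)// lerD2r exprS -natr1.
    have : 0 <= b * b ^+ n * t by rewrite !mulr_ge0 ?exprn_ge0 ?(ltW b0)//; lra.
    by nra.
  move=> x hx; rewrite step; last by lra.
  have -> : (b^-1 <= x) = false by lra.
  have [|p pP e] := hP (b * x - 0).
    by rewrite subr0 mulr_ge0 ?ltr_pM2l ?(ltW b0)//; lra.
  by exists ((p + 0) / b); [exact: map_f|exact: branch].
have bt1 : 1 < b * t by rewrite -ltr_pdivrMl// mulr1.
have hbt : 0 <= b * t - 1 <= 1.
  have : b * t <= b by rewrite -[leRHS]mulr1 ler_pM2l//; lra.
  by lra.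
have [|P0 sP0 hP0] := IH 1; first by rewrite ler01 lexx.
have [P1 sP1 hP1] := IH _ hbt.
exists ([seq (p + 0) / b | p <- P0] ++ [seq (p + 1) / b | p <- P1]).
  (* The two counts add up to at most [n * b ^+ n.+1 * t + 2]; the surplus 1 is paid for by
     [b ^+ n.+1 * t >= 1]. *)
  rewrite size_cat !size_map natrD (le_trans (lerD sP0 sP1))// exprS -natr1.
  have : 1 <= b * b ^+ n * t.
    by rewrite mulrAC -[leLHS]mulr1 ler_pM// ltW.
  by lra.
move=> x hx; rewrite step; last by lra.
have [xb|xb] := leP b^-1 x.
  have [|p pP e] := hP1 (b * x - 1).
    have : 1 <= b * x by rewrite -ler_pdivrMl// mulr1.
    have : b * x < b * t by rewrite ltr_pM2l//; lra.
    by lra.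
  exists ((p + 1) / b); last exact: branch.
  by rewrite mem_cat (map_f (fun p => (p + 1) / b)) ?orbT.
have [|p pP e] := hP0 (b * x - 0).
  by rewrite subr0 mulr_ge0 ?(ltW b0) -?ltr_pdivlMl ?mulr1//; lra.
exists ((p + 0) / b); last exact: branch.
by rewrite mem_cat (map_f (fun p => (p + 0) / b)).
Qed.

End BetaMap.

(** * Orbits that come too close to a given point form a null set *)

Section NullSet.
Context {R : realType}.
Implicit Types (b c d e x : R) (n : nat).

Local Notation mu := (@lebesgue_measure R).

(** For [t = 1] there are at most [n * b ^+ n + 1] centers. Balls of radius [d / b ^+ n] around them
    have total length at most [2 d (n + b^-n)]. *)
Lemma near_preimage_cover b c d n : 1 < b <= 2 -> 0 < d ->
  exists U : set R, [/\ measurable U,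
    (mu U <= (d * n.+1%:R *+ 2)%:E)%E &
    forall x, 0 <= x < 1 -> `|iter n (beta_map b) x - c| < d -> U x].
Proof.
move=> hb d0; have b0 : 0 < b by lra.
have bn0 : 0 < b ^+ n by rewrite exprn_gt0.
have bn1 : 1 <= b ^+ n by rewrite exprn_ege1//; lra.
have [|P sP hP] := @preimage_centers R b c n 1 hb; first by rewrite ler01 lexx.
pose B i : set R := ball (P`_i) (d / b ^+ n).
exists (\big[setU/set0]_(i < size P) B i); split.
- by apply: bigsetU_measurable => i _; exact: measurable_realfun.measurable_ball.
- apply: le_trans (Boole_inequality _ _) _ => [i _|].
    exact: measurable_realfun.measurable_ball.
  rewrite (eq_bigr (fun=> (d / b ^+ n *+ 2)%:E)) => [|i _]; last first.
    by apply: lebesgue_measure_ball; rewrite divr_ge0// ltW.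
  rewrite sumEFin lee_fin sumr_const card_ord.
  rewrite -mulrnA mulnC mulrnA lerMn2r/= -[leLHS]mulr_natr -mulrA ler_pM2l//.
  rewrite ler_pdivrMl// (le_trans sP)// mulr1 -natr1.
  by rewrite mulrDr mulr1 mulrC lerD2l.
- move=> x hx hd; have [p pP e] := hP x hx.
  rewrite -bigcup_mkord; exists (index p P); first by rewrite /= index_mem.
  rewrite /B nth_index// /ball/= ltr_pdivlMr// mulrC distrC -e.
  exact: hd.
Qed.

(** The cover at time [n] has measure at most [2 e (n+1) / (n+2)^3]; the cube makes this summable
    despite the factor [n + 1]. *)
Lemma close_return_cover b c e : 1 < b <= 2 -> 0 < e ->
  exists U : set R, [/\ measurable U, (mu U <= (e *+ 2)%:E)%E &
    forall x, 0 <= x < 1 ->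
      (exists n, `|iter n (beta_map b) x - c| < e / n.+2%:R ^+ 3) -> U x].
Proof.
move=> hb e0.
have dn0 n : 0 < e / n.+2%:R ^+ 3 by rewrite divr_gt0// exprn_gt0.
have /choice[U hU] n := near_preimage_cover b c _ n hb (dn0 n).
have mU n : measurable (U n) by have [] := hU n.
exists (\bigcup_n U n); split; first exact: bigcup_measurable.
- have mbU : measurable (\bigcup_n U n) by exact: bigcup_measurable.
  apply: le_trans (generalized_Boole_inequality mu mU mbU) _.
  apply: lime_le; first exact: is_cvg_nneseries.
  apply: nearW => N.
  (* Telescoping: with [m = N + 1], the new summand [2 e m / (m+1)^3] is at most
     [2 e (1/m - 1/(m+1))]. *)
  apply: (@le_trans _ _ ((e *+ 2) * (1 - N.+1%:R^-1))%:E); last first.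
    by rewrite lee_fin ler_piMr ?mulrn_wge0 ?(ltW e0)// gerBl.
  elim: N => [|N IH]; first by rewrite big_geq// invr1 subrr mulr0.
  rewrite big_nat_recr//=; have [_ h _] := hU N.
  apply: le_trans (leeD IH h) _; rewrite -EFinD lee_fin -subr_ge0.
  have n1 : (0 : R) < N.+1%:R by [].
  rewrite -[N.+2%:R]natr1; set m := N.+1%:R in n1 *.
  have -> : e *+ 2 * (1 - (m + 1)^-1) - (e *+ 2 * (1 - m^-1) +
      e / (m + 1) ^+ 3 * m *+ 2) =
      e *+ 2 * (m *+ 2 + 1) / (m * (m + 1) ^+ 3).
    by field; apply/andP; split; lra.
  by rewrite divr_ge0 ?mulr_ge0 ?exprn_ge0//; lra.
- by move=> x hx [n hn]; exists n => //; have [_ _] := hU n; exact.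
Qed.

(** Taking [e = 1 / (2 (k+1))] puts the set inside a cover of measure at most [1 / (k+1)] for every
    [k], and the intersection of these covers is null. *)
Lemma negligible_close_return b c : 1 < b <= 2 ->
  mu.-negligible [set x | 0 <= x < 1 /\ forall e, 0 < e ->
    exists n, `|iter n (beta_map b) x - c| < e / n.+2%:R ^+ 3].
Proof.
move=> hb; have k0 k : (0 : R) < k.+1%:R^-1 / 2 by rewrite divr_gt0.
have /choice[U hU] k := close_return_cover b c _ hb (k0 k).
have mU k : measurable (U k) by have [] := hU k.
exists (\bigcap_k U k); split; first exact: bigcapT_measurable.
- apply/eqP; rewrite eq_le measure_ge0 andbT.
  apply/lee_addgt0Pr => e e0; rewrite add0e.
  have [k _ /(_ k (leqnn k))/= ke] := near_infty_natSinv_lt (PosNum e0).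
  apply: (@le_trans _ _ (mu (U k))).
    apply: le_measure; rewrite ?inE; [exact: bigcapT_measurable|exact: mU|].
    by move=> z; apply.
  have [_ h _] := hU k; apply: le_trans h _.
  rewrite lee_fin; move: ke; set i := k.+1%:R^-1 => ke.
  by rewrite mulr2n -splitr ltW.
- by move=> x [hx h] k _; have [_ _] := hU k; apply => //; exact: h.
Qed.

End NullSet.

(** * The pointwise Hölder estimate and the set of full measure *)

Lemma powR_gt1 (R : realType) (a p : R) : 1 < a -> 0 < p -> 1 < a `^ p.
Proof.
move=> a1 p0; rewrite lt_neqAle eq_sym powR_eq1 !negb_or !gt_eqF//= -leNgt.
rewrite andbT (le_trans ler01 (ltW a1))/=.
by rewrite -(powRr0 a) ler_powR// ltW.
Qed.

Lemma takagi_holder_at (R : realType) (b : R) (m : set R -> \bar R)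
    (e x alpha : R) :
  1 < b <= 2 -> 0 <= x < 1 -> 0 < e ->
  (forall n, e / n.+2%:R ^+ 3 <= `|iter n (beta_map b) x - b^-1|) ->
  0 < alpha < 1 ->
  exists C : R, 0 < C /\ forall y, 0 <= y < 1 ->
    `|takagi b m y - takagi b m x| <= C * `|y - x| `^ alpha.
Proof.
move=> hb hx e0 he ha; have b0 : 0 < b by lra.
(* Each linear factor in [k] will cost [q ^+ k], that is [b] to the power [s k]. Terms then decay
   like [b] to the [(s - 1) k], while distances are at least of order [b] to the [-(3 s + 1) k];
   this [s] ensures [(3 s + 1) alpha <= 1 - s]. *)
pose M := Mbeta b m; pose s := (1 - alpha) / 4.
have s0 : 0 < s by rewrite /s; lra.
have s1 : s < 1 by rewrite /s; lra.
pose q := b `^ s; pose r := q / b; pose D := 2 + (q - 1)^-1.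
have q0 : 0 < q by exact: powR_gt0.
have q1 : 1 < q.
  by apply: powR_gt1 => //; lra.
have bD u v : b `^ (u + v) = b `^ u * b `^ v.
  by apply: powRD; rewrite (gt_eqF b0)/= implybT.
have qb : q < b.
  have : 1 < b `^ (1 - s) by apply: powR_gt1; lra.
  rewrite -(ltr_pM2l q0) mulr1 -bD addrC subrK powRr1//; exact: ltW.
have rE : r = b `^ (s - 1) by rewrite /r bD powR_inv1// ltW.
have D0 : 0 < D by rewrite addr_gt0// invr_gt0 subr_gt0.
have r0 : 0 < r by rewrite divr_gt0.
have r1 : r < 1 by rewrite ltr_pdivrMr// mul1r.
pose A := (1 + `|M^-1|) * D.
have A0 : 0 < A by rewrite mulr_gt0// ltr_pwDl.
have termA z : 0 <= z < 1 -> forall k, `|takagi_term b M z k| <= A * r ^+ k.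
  move=> hz k; apply: le_trans (takagi_term_le _ _ _ _ hb hz) _.
  rewrite /r expr_div_n mulrA ler_pM2r ?invr_gt0 ?exprn_gt0// /A -mulrA.
  rewrite ler_pM2l ?ltr_pwDl//; apply: le_trans (natr_le_exp _ k q1).
  by rewrite ler_nat.
have takagiE z : takagi b m z = limn (series (takagi_term b M z)).
  rewrite /takagi; congr (lim _).
  by congr (_ @ \oo); apply/funext => n; rewrite /series/= big_mkord.
pose L := e / D ^+ 3.
have L0 : 0 < L by rewrite divr_gt0// exprn_gt0.
(* The factor [A *+ 2 / (1 - r)] comes from the geometric tail; dividing by the power of [L]
   accounts for [r ^+ k] being at most the [alpha]-th power of [|y - x| / L]. *)
exists (A *+ 2 / (1 - r) / L `^ alpha); split.
  by rewrite !divr_gt0 ?powR_gt0 ?subr_gt0 ?pmulrn_lgt0.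
move=> y hy; rewrite !takagiE.
have termE k : (forall i, (i <= k)%N -> digit b i.+1 x = digit b i.+1 y) ->
    takagi_term b M y k = takagi_term b M x k.
  move=> E; rewrite /takagi_term E//; congr (_ * (_ - _ * _)).
  by apply: eq_bigr => i _; rewrite E// ltnW.
have rhs0 : 0 <= A *+ 2 / (1 - r) / L `^ alpha * `|y - x| `^ alpha.
  rewrite mulr_ge0 ?powR_ge0// divr_ge0 ?powR_ge0// divr_ge0 ?subr_ge0 ?ltW//.
  by rewrite pmulrn_lgt0.
have [E|] := pselect (forall k, digit b k.+1 x = digit b k.+1 y).
  have -> : takagi_term b M y = takagi_term b M x.
    by apply/funext => k; exact: termE.
  by rewrite subrr normr0.
move=> /existsNP[k0 /eqP k0P].
have [k kP kmin] := ex_minnP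
  (ex_intro (fun k => digit b k.+1 x != digit b k.+1 y) k0 k0P).
have pre i : (i < k)%N -> digit b i.+1 x = digit b i.+1 y.
  by move=> ik; apply/eqP; apply: contraTT ik => /kmin; rewrite leqNgt.
have rk : A *+ 2 / (1 - r) * r ^+ k <=
    A *+ 2 / (1 - r) / L `^ alpha * `|y - x| `^ alpha.
  rewrite -[leRHS]mulrA ler_pM2l ?divr_gt0 ?subr_gt0 ?pmulrn_lgt0//.
  rewrite mulrC ler_pdivlMr ?powR_gt0// mulrC.
  have wE : b `^ ((3 * s + 1) * k%:R) = (q ^+ k) ^+ 3 * b ^+ k.
    have -> : (3 * s + 1) * k%:R = s * k%:R * 3 + k%:R by ring.
    by rewrite bD (powRrM _ (s * _)) (powRrM _ s) !powR_mulrn ?exprn_ge0 ?powR_ge0 ?(ltW b0).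
  (* The orbit distance [e / (k+2)^3] is at least [L / q^(3k)], because [k + 2 <= D * q ^+ k];
     dividing by [b ^+ k] gives the exponent. *)
  have h : L * b `^ (- ((3 * s + 1) * k%:R)) <= `|y - x|.
    have := le_trans (he k) (first_digit_dist _ _ _ _ hb hx hy pre kP).
    rewrite -ler_pdivrMl ?exprn_gt0// => yx; apply: le_trans yx.
    rewrite [leRHS]mulrC powRN wE invfM mulrA ler_pM2r ?invr_gt0 ?exprn_gt0// /L -mulrA.
    rewrite -invfM -exprMn ler_pM2l//.
    rewrite lef_pV2 ?posrE ?exprn_gt0 ?mulr_gt0 ?exprn_gt0//.
    rewrite lerXn2r ?nnegrE ?mulr_ge0 ?exprn_ge0 ?(ltW D0) ?(ltW q0)//.
    exact: natr_le_exp.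
  apply: (@le_trans _ _ ((L * b `^ (- ((3 * s + 1) * k%:R))) `^ alpha)).
    rewrite powRM ?powR_ge0 ?(ltW L0)// ler_pM2l ?powR_gt0//.
    rewrite rE -powR_mulrn ?powR_ge0// -!powRrM ler_powR; [by []|lra|].
    (* The gap between the exponents is exactly [(3/4) (1 - alpha)^2 k]. *)
    rewrite -subr_ge0.
    have -> : - ((3 * s + 1) * k%:R) * alpha - (s - 1) * k%:R =
        k%:R * (3 / 4) * (1 - alpha) ^+ 2 by rewrite /s; field.
    by rewrite !mulr_ge0 ?sqr_ge0//; lra.
  apply: ge0_ler_powR; rewrite ?nnegrE //; first by lra.
  by apply: mulr_ge0; [exact: ltW|exact: powR_ge0].
apply: le_trans rk.
apply: lim_series_eq_prefix; [exact: ltW|by rewrite ltW|exact: termA..|].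
(* Term [i] involves only the digits up to [i + 1], so the terms of index below [k] coincide. *)
move=> i ik; apply: termE => j ji; apply: pre; exact: leq_ltn_trans ik.
Qed.

Theorem theorem3p3 (R : realType) (beta : R) (m : probability R R) :
  1 < beta <= 2 ->
  m [set` `[0, 1]] = 1%E ->
  beta_invariant beta m ->
  m `<< (@lebesgue_measure R) ->
  exists F : set R,
    F `<=` [set` `[0, 1]] /\
    (@lebesgue_measure R).-negligible ([set` `[0, 1]] `\` F) /\
    forall x, F x -> forall alpha : R, 0 < alpha < 1 ->
      exists C : R, 0 < C /\
        forall y, y \in `]0, 1[ ->
          `|takagi beta m y - takagi beta m x| <= C * `|y - x| `^ alpha.
Proof.
move=> hb _ _ _.
(* These are the points whose orbit approaches the discontinuity [beta^-1] at most polynomially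
   fast. In [[0, 1]] the complement lies in the union of the point 1 and the null set of close
   returns. *)
exists [set x | 0 <= x < 1 /\ exists2 e : R, 0 < e & forall n,
  e / n.+2%:R ^+ 3 <= `|iter n (beta_map beta) x - beta^-1|].
split; [|split].
- by move=> x [/andP[x0 x1] _] /=; rewrite in_itv/= x0 ltW.
- have n1 : (@lebesgue_measure R).-negligible [set (1 : R)].
    by apply/negligibleP => //; exact: lebesgue_measure_set1.
  apply: negligibleS (negligibleU n1 (negligible_close_return beta beta^-1 hb)).
  move=> x [/=]; rewrite in_itv/= => /andP[x0 x1] nF.
  have [->|xn1] := eqVneq x 1; [by left|right].
  have hx : 0 <= x < 1 by rewrite x0 lt_neqAle xn1.
  split=> // e e0; apply: contrapT => /forallNP h; apply: nF; split => //.
  by exists e => // n; rewrite leNgt; apply/negP; exact: h.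
- move=> x [hx [e e0 he]] alpha ha.
  have [C [C0 hC]] := takagi_holder_at R beta m e x alpha hb hx e0 he ha.
  exists C; split=> // y; rewrite in_itv/= => /andP[y0 y1].
  by apply: hC; rewrite ltW.
Qed.
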